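(* Let $\mathcal{S}$ be a commutative semigroup. Then: (i) If $\mathcal{S}$ is a monoid and $a\in\mathrm{U}(\mathcal{S})$, then $\mathrm{D}_a(\mathcal{S})=\mathrm{D}_a(\mathrm{U}(\mathcal{S}))$. (ii) $\mathrm{D}(\mathcal{S})$ is finite if and only if $\mathrm{D}_a(\mathcal{S})$ is bounded for all $a\in\mathcal{S}$, i.e. there exists an integer $\mathcal{M}$ such that $\mathrm{D}_a(\mathcal{S})\leq\mathcal{M}$ for all $a\in\mathcal{S}$. In particular, if $\mathrm{D}(\mathcal{S})$ is finite, then $$\mathrm{D}(\mathcal{S})=\max_{a\in\mathcal{S}}\{\mathrm{D}_a(\mathcal{S})\}+1.$$
   Context: Commutative semigroups $\mathcal{S}$ are written additively. The identity element of $\mathcal{S}$, if it exists, is denoted $0_{\mathcal{S}}$, and then $\mathcal{S}$ is called a monoid, with group of units $\mathrm{U}(\mathcal{S})=\{a\in\mathcal{S}: a+a'=0_{\mathcal{S}}\text{ for some }a'\in\mathcal{S}\}$. A sequence over $\mathcal{S}$ is a finite multiset $T$ of elements of $\mathcal{S}$, $|T|$ is its length (number of terms with multiplicity), and $\sigma(T)$ is the sum of its terms. If $\mathcal{S}$ is a monoid, the empty sequence is allowed and has sum $0_{\mathcal{S}}$; if $\mathcal{S}$ has no identity, the empty sequence has no sum. $T$ is reducible if it has a proper subsequence $T'\neq T$ with $\sigma(T')=\sigma(T)$ (the empty one being considered only when $\mathcal{S}$ is a monoid), and irreducible otherwise. $\mathrm{D}(\mathcal{S})$ is the smallest $\ell\in\mathbb{N}\cup\{\infty\}$,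 with $\mathbb{N}=\{1,2,\dots\}$, such that every sequence over $\mathcal{S}$ of length at least $\ell$ is reducible. For $a\in\mathcal{S}$ with $a$ not the identity of $\mathcal{S}$, $\mathrm{D}_a(\mathcal{S})\in\mathbb{N}\cup\{\infty\}$ is the largest length (supremum of lengths) of irreducible sequences $T$ over $\mathcal{S}$ with $\sigma(T)=a$. By convention $\mathrm{D}_a(\mathcal{S})=0$ if $a=0_{\mathcal{S}}$. *)

(* Defs.v *)
From HB Require Import structures.
From mathcomp Require Import all_boot all_order all_algebra finmap multiset.
From mathcomp Require Import boolp classical_sets reals constructive_ereal ereal.

Set Implicit Arguments.
Unset Strict Implicit.
Unset Printing Implicit Defensive.

Import Order.TTheory GRing.Theory Num.Theory.
Local Open Scope mset_scope.
Local Open Scope classical_set_scope.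
Local Open Scope ring_scope.

Definition is_identity (S : addSemigroupType) (e : S) : Prop :=
  forall x : S, e + x = x.

Definition is_monoid (S : addSemigroupType) : Prop :=
  exists e : S, is_identity e.

(* The identity of S if there is one; it is unique, addition being
   commutative in an [addSemigroupType]. *)
Definition opt_identity (S : addSemigroupType) : option S :=
  if pselect (is_monoid S) is left h then Some (projT1 (cid h)) else None.

(* [None] means "no sum": this only happens for the empty sequence over a
   semigroup without identity.  [oAC] extends addition to [option S] with
   [None] as neutral element. *)
Definition sigma (S : addSemigroupType) (T : {mset S}) : option S :=
  \big[oAC (@Algebra.addrA S) (@Algebra.addrC S) / opt_identity S]_(x <- T) Some x.

Definition reducible (S : addSemigroupType) (T : {mset S}) : Prop :=
  exists T' : {mset S},
    [/\ (T' `<=` T)%mset, T' <> T, sigma T' <> None & sigma T' = sigma T].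

Definition irreducible (S : addSemigroupType) (T : {mset S}) : Prop :=
  ~ reducible T.

(* Elements of N with infinity added are represented in the extended reals;
   the infimum of a nonempty set of naturals is its least element and that of
   the empty set is +oo. *)

Definition D (R : realType) (S : addSemigroupType) : \bar R :=
  ereal_inf [set (l%:R)%:E | l in
    [set l : nat | (0 < l)%N /\
       forall T : {mset S}, (l <= size T)%N -> reducible T]].

Definition D_at (R : realType) (S : addSemigroupType) (a : S) : \bar R :=
  if `[< is_identity a >] then 0%E
  else ereal_sup [set ((size T)%:R)%:E | T in
    [set T : {mset S} | irreducible T /\ sigma T = Some a]].

Definition is_unit (S : addSemigroupType) (a : S) : Prop :=
  exists e : S, is_identity e /\ exists a' : S, a + a' = e.

Record units (S : addSemigroupType) : Type := Units {
  unit_val :> S;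
  _ : `[< is_unit unit_val >]
}.

Section UnitsSemigroup.
Variable S : addSemigroupType.

HB.instance Definition _ := [isSub for @unit_val S].
HB.instance Definition _ := [Choice of units S by <:].

Lemma units_add_subproof (u v : units S) : `[< is_unit (val u + val v) >].
Proof.
have [/asboolP[e [eI [u' ue]]] /asboolP[f [fI [v' vf]]]] := (valP u, valP v).
apply/asboolP; exists e; split=> //; exists (u' + v').
have ef : e = f by rewrite -(fI e) Algebra.addrC eI.
by rewrite Algebra.addrACA ue vf ef fI.
Qed.

Definition units_add (u v : units S) : units S :=
  Units (units_add_subproof u v).

Lemma units_addC : commutative units_add.
Proof. by move=> u v; apply: val_inj; rewrite /= Algebra.addrC. Qed.

Lemma units_addA : associative units_add.
Proof. by move=> u v w; apply: val_inj; rewrite /= Algebra.addrA. Qed.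

HB.instance Definition _ :=
  Algebra.isAddSemigroup.Build (units S) units_addC units_addA.

End UnitsSemigroup.

(* Main.v *)
(* (i) A summand of a unit is a unit, so every sequence summing to a unit consists
   of units, and so does each of its subsequences; irreducibility over S and over
   U(S) therefore agree for it.
   (ii) A positive l is admissible in the definition of D(S) exactly when all irreducible sequences
   are shorter than l, so D(S) is one more than the maximal length of an irreducible
   sequence. A longest one, when nonempty, has a sum a, and D_a(S) is its length. *)

Require Import Defs.
From mathcomp Require Import all_boot all_order all_algebra finmap multiset.
From mathcomp Require Import boolp classical_sets reals constructive_ereal ereal.

Section Irreducible.
Import Order.TTheory GRing.Theory Num.Theory.
Set Implicit Arguments.
Unset Strict Implicit.
Unset Printing Implicit Defensive.
Local Open Scope mset_scope.
Local Open Scope classical_set_scope.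
Local Open Scope ring_scope.

Implicit Type S : addSemigroupType.

(** * Identities, sums and sequences of length at most one *)

Lemma is_identity_unique S (e f : S) : is_identity e -> is_identity f -> e = f.
Proof. by move=> eI fI; rewrite -(fI e) Algebra.addrC eI. Qed.

Lemma opt_identityP S (e : S) : opt_identity S = Some e <-> is_identity e.
Proof.
rewrite /opt_identity; case: pselect => [h|nh].
  split=> [[<-]|eI]; first exact: (projT2 (cid h)).
  by congr Some; apply: is_identity_unique eI; exact: (projT2 (cid h)).
by split=> // eI; case: nh; exists e.
Qed.

Lemma oAC_Some S (x : S) y :
  exists z, oAC (@Algebra.addrA S) (@Algebra.addrC S) (Some x) y = Some z.
Proof. by case: y => [y|]; eexists. Qed.

Lemma sigma_seq_mset S (s : seq S) :
  sigma (seq_mset s) =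
  \big[oAC (@Algebra.addrA S) (@Algebra.addrC S) / opt_identity S]_(x <- s) Some x.
Proof. exact: perm_big (perm_eq_seq_mset s). Qed.

Lemma sigma0 S : sigma (@mset0 S) = opt_identity S.
Proof. by rewrite /sigma enum_mset0 big_nil. Qed.

Lemma sigma1 S (a : S) : sigma [mset a] = Some a.
Proof.
(* The fold over one term still ends in the seed [opt_identity S], so an identity [e], if there is
   one, leaves [a + e] to simplify. *)
rewrite /sigma enum_msetn big_seq1_id.
case E: (opt_identity S) => [e|//]; move/opt_identityP: E => eI.
by rewrite oACE Algebra.addrC eI.
Qed.

(** A single term already makes the fold a [Some], and no further summand, not even [None], undoes
    that. *)
Lemma sigma_neq0 S (T : {mset S}) : T <> mset0 -> exists a, sigma T = Some a.
Proof.
rewrite -(seq_mset_id T) sigma_seq_mset; case: {T}(T : seq S) => [[]|x s _].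
  by apply/msetP => x; rewrite mset_seqE mset0E.
by rewrite big_cons; exact: oAC_Some.
Qed.

Lemma irreducible0 S : irreducible (@mset0 S).
Proof. by case=> T []; rewrite msubset0 => /eqP. Qed.

(** Otherwise the empty sequence would be a proper subsequence with the same sum. This reconciles
    the convention [D_at R e = 0] with actual lengths. *)
Lemma irreducible_identity S (e : S) (T : {mset S}) :
  is_identity e -> irreducible T -> sigma T = Some e -> T = mset0.
Proof.
move=> /opt_identityP eI irrT sT; apply: contrapT => T0; apply: irrT.
by exists mset0; split; rewrite ?msub0set ?sigma0 ?eI //; exact/nesym.
Qed.

Lemma irreducible1 S (a : S) : ~ is_identity a -> irreducible [mset a].
Proof.
move=> aN [T [/msubsetP Ta Tna sT]]; rewrite sigma1 => sTa.
suff T0 : T = mset0 by apply/aN/opt_identityP; rewrite -sigma0 -T0.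
apply: contrapT => T0; apply: Tna; apply/msetP => x; rewrite msetnE.
(* Multiplicities in [T] are at most one at [a] and zero elsewhere, so a term [b] of [T] must be
   [a], and then [T] is all of [[mset a]]. *)
have {}Ta y : (T y <= (y == a))%N by have := Ta y; rewrite msetnE; case: eqP.
have [b bT] : exists b, b \in T.
  apply: contrapT => nb; apply: T0; apply/msetP => y; rewrite mset0E.
  by apply/eqP; rewrite mset_eq0; apply/negP => yT; apply: nb; exists y.
have ba : b = a by have := Ta b; move: bT; rewrite in_mset; case: eqP; case: (T b).
apply/eqP; rewrite eqn_leq; case: eqP (Ta x) => [->|_] -> //.
by rewrite -ba -in_mset.
Qed.

(** * Sequences over the group of units *)

Section Units.
Variable S : addSemigroupType.
Hypothesis S_monoid : is_monoid S.

Definition mset_val (T : {mset units S}) : {mset S} :=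
  seq_mset (map (@unit_val S) T).

Lemma mset_val_val T u : mset_val T (unit_val u) = T u.
Proof.
rewrite mset_seqE count_map -count_mem_mset; apply: eq_count => v /=.
exact: (inj_eq val_inj).
Qed.

Lemma mset_val_inj : injective mset_val.
Proof. by move=> A B AB; apply/msetP => u; rewrite -!mset_val_val AB. Qed.

Lemma size_mset_val T : size (mset_val T) = size T.
Proof. by rewrite (perm_size (perm_eq_seq_mset _)) size_map. Qed.

Lemma is_unit_mset_val T x : x \in mset_val T -> is_unit x.
Proof.
rewrite (perm_mem (perm_eq_seq_mset _)) => /mapP[u _ ->].
exact/asboolP/(valP u).
Qed.

Lemma mset_val_surj (T : {mset S}) :
  (forall x, x \in T -> is_unit x) -> exists T', mset_val T' = T.
Proof.
move=> TU; exists (seq_mset (pmap insub T)).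
rewrite -[RHS]seq_mset_id; apply/eq_seq_msetP.
apply: perm_trans (perm_map (@unit_val S) (perm_eq_seq_mset _)) _.
rewrite (pmap_filter (insubK _)) (_ : [seq _ <- _ | _] = T) //.
by apply/all_filterP/allP => x /TU/asboolP xU; rewrite insubT.
Qed.

Lemma mset_val_sub A B : (mset_val A `<=` mset_val B)%mset = (A `<=` B)%mset.
Proof.
apply/msubsetP/msubsetP => AB x; first by rewrite -!mset_val_val.
have [/is_unit_mset_val/asboolP xU|] := boolP (x \in mset_val A).
  by rewrite -[x]/(unit_val (Units xU)) !mset_val_val.
by rewrite -mset_eq0 => /eqP ->.
Qed.

(** The identity is its own inverse, hence a unit, so the empty sequences over [units S] and over
    [S] have the same sum. *)
Lemma opt_identity_units : omap (@unit_val S) (opt_identity (units S)) = opt_identity S.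
Proof.
have [e eI] := S_monoid.
have eU : `[< is_unit e >] by apply/asboolP; exists e; split=> //; exists e.
have /opt_identityP -> : is_identity (Units eU).
  by move=> u; apply: val_inj; exact: eI.
by apply/esym/opt_identityP.
Qed.

Lemma sigma_mset_val T : sigma (mset_val T) = omap (@unit_val S) (sigma T).
Proof.
rewrite sigma_seq_mset big_map; apply/esym/(big_morph (omap (@unit_val S))).
  by move=> [x|] [y|].
exact: opt_identity_units.
Qed.

(** A subsequence of [mset_val T] has only units as terms, so it lifts to [units S]; inclusion,
    distinctness and sums carry over in both directions. *)
Lemma reducible_mset_val T : reducible (mset_val T) <-> reducible T.
Proof.
split=> [[A [AT AnT sA sAT]]|[A [AT AnT sA sAT]]].
  have [B BA] : exists B, mset_val B = A.
    by apply: mset_val_surj => x /(msubset_subset AT)/is_unit_mset_val.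
  move: AT AnT sA sAT; rewrite -{}BA mset_val_sub !sigma_mset_val => BT BnT sB sBT.
  exists B; split=> //; first by move=> BT'; case: BnT; rewrite BT'.
    by move=> sB0; rewrite sB0 in sB.
  exact: (inj_omap val_inj).
exists (mset_val A); split; rewrite ?mset_val_sub ?sigma_mset_val ?sAT //.
- by move/mset_val_inj.
- by move: sA; rewrite -sAT; case: (sigma A).
Qed.

Lemma is_unit_addl (x y : S) : is_unit (x + y) -> is_unit x.
Proof.
by move=> [e [eI [z xyz]]]; exists e; split=> //; exists (y + z); rewrite Algebra.addrA.
Qed.

Lemma is_unit_term (T : {mset S}) a x :
  sigma T = Some a -> is_unit a -> x \in T -> is_unit x.
Proof.
move=> sT aU xT; move: sT; rewrite -(msetB1K xT) -(seq_mset_id (_ `\ x)%mset).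
rewrite -mset_cons sigma_seq_mset big_cons.
(* The remaining terms either sum to some [y], with [x + y = a], or have no sum, and then
   [x = a]. *)
case: (\big[_/_]_(_ <- _) _) => [y|] [xa]; rewrite -xa in aU => //.
exact: is_unit_addl aU.
Qed.

Lemma D_at_units (R : realType) (u : units S) : D_at R (unit_val u) = D_at R u.
Proof.
(* The conventional value 0 must be taken on both sides at once. *)
have idE : is_identity (unit_val u) <-> is_identity u.
  rewrite -!opt_identityP -opt_identity_units.
  by split=> [|->//]; case: opt_identity => //= v [/val_inj ->].
rewrite /D_at (asbool_equiv_eq idE); case: ifP => // _.
congr ereal_sup; apply/seteqP; split=> _ [T [irrT sT] <-].
  have [T' T'T] : exists T', mset_val T' = T.
    by apply: mset_val_surj => x; apply: is_unit_term sT _; exact/asboolP/(valP u).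
  exists T'; last by rewrite -T'T size_mset_val.
  rewrite -{}T'T in irrT sT; split; first by move=> /reducible_mset_val.
  by apply: (inj_omap val_inj); rewrite -sigma_mset_val.
exists (mset_val T); last by rewrite size_mset_val.
by split; [move=> /reducible_mset_val | rewrite sigma_mset_val sT].
Qed.

End Units.

(** * Lengths of irreducible sequences and the value of [D] *)

Variables (R : realType) (S : addSemigroupType).

Lemma size_le_D_at (T : {mset S}) a :
  irreducible T -> sigma T = Some a -> (((size T)%:R)%:E <= D_at R a)%E.
Proof.
move=> irrT sT; rewrite /D_at; case: asboolP => [aI|_].
  by rewrite (irreducible_identity aI irrT sT) enum_mset0.
by apply: ereal_sup_ubound; exists T.
Qed.

Lemma D_at_le (k : nat) (a : S) :
  (forall T : {mset S}, irreducible T -> (size T <= k)%N) ->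
  (D_at R a <= (k%:R)%:E)%E.
Proof.
move=> Tk; rewrite /D_at; case: asboolP => _; first by rewrite lee_fin ler0n.
by apply: ge_ereal_sup => _ [T [/Tk Tle _] <-]; rewrite lee_fin ler_nat.
Qed.

(** The empty sequence is irreducible, so the set of lengths is nonempty as well as bounded. *)
Lemma ex_max_irreducible (k : nat) :
  (forall T : {mset S}, irreducible T -> (size T <= k)%N) ->
  exists2 T : {mset S}, irreducible T &
    forall T' : {mset S}, irreducible T' -> (size T' <= size T)%N.
Proof.
move=> kP.
pose P n := `[< exists2 T : {mset S}, irreducible T & size T = n >].
have exP : exists n, P n.
  by exists 0%N; apply/asboolP; exists mset0; rewrite ?enum_mset0 //; exact: irreducible0.
have leP n : P n -> (n <= k)%N by move=> /asboolP[T /kP ? <-].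
have [_ /asboolP[T irrT <-] maxT] := ex_maxnP exP leP.
by exists T => // T' irrT'; apply/maxT/asboolP; exists T'.
Qed.

Lemma D_eq_max_size (T : {mset S}) : irreducible T ->
  (forall T' : {mset S}, irreducible T' -> (size T' <= size T)%N) ->
  D R S = ((size T)%:R + 1)%:E.
Proof.
move=> irrT maxT; rewrite natr1; apply/eqP; rewrite eq_le; apply/andP; split.
  apply: ereal_inf_lbound; exists (size T).+1 => //; split=> // T' ltT'.
  by apply: contrapT => /maxT; rewrite leqNgt ltT'.
apply: le_ereal_inf_tmp => _ [l [_ lP] <-]; rewrite lee_fin ler_nat ltnNge.
by apply/negP => /lP.
Qed.

Lemma D_fin_numP : D R S \is a fin_num <->
  exists k, forall T : {mset S}, irreducible T -> (size T <= k)%N.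
Proof.
split=> [Dfin|[k kP]].
  have : (D R S < +oo)%E by rewrite ltey_eq Dfin.
  (* An infimum below [+oo] yields an admissible [l], which serves as a bound, though not a sharp
     one. *)
  move=> /ereal_inf_lt[_ [l [_ lP] _] _]; exists l => T irrT.
  by rewrite leqNgt; apply/negP => /ltnW/lP.
have [T irrT maxT] := ex_max_irreducible kP.
by rewrite (D_eq_max_size irrT maxT).
Qed.

Lemma D_fin_num_bounded : D R S \is a fin_num <->
  exists M : int, forall a : S, (D_at R a <= (M%:~R)%:E)%E.
Proof.
rewrite D_fin_numP; split=> [[k kP]|[M MP]].
  by exists (Posz k) => a; exact: D_at_le.
(* The absolute value turns the integer [M] into a natural bound. The empty sequence is set apart
   because it may have no sum at which to apply [MP]. *)
exists `|M|%N => T irrT.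
have [->|/eqP/sigma_neq0[a sT]] := eqVneq T mset0; first by rewrite enum_mset0.
have := le_trans (size_le_D_at irrT sT) (MP a).
rewrite lee_fin -[_%:R]/((Posz (size T))%:~R) ler_int => leM.
by rewrite -lez_nat (le_trans leM) // abszE ler_norm.
Qed.

(** A longest irreducible sequence attains the maximum at its sum; if it is empty, the element
    supplied by [inhabited S] does. *)
Lemma D_max : inhabited S -> D R S \is a fin_num ->
  exists a : S, (forall b : S, (D_at R b <= D_at R a)%E) /\
    D R S = (D_at R a + 1)%E.
Proof.
move=> [s] /D_fin_numP[k /ex_max_irreducible[T irrT maxT]].
suff [a Da] : exists a : S, D_at R a = ((size T)%:R)%:E.
  exists a; split=> [b|]; first by rewrite Da; exact: D_at_le.
  by rewrite (D_eq_max_size irrT maxT) Da.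
have [T0|/eqP/sigma_neq0[a sT]] := eqVneq T mset0.
  (* D(S) = 1 forces S to be trivial, and D_0(S) = 0. *)
  exists s; have sI : is_identity s.
    apply: contrapT => /irreducible1/maxT.
    by rewrite T0 enum_mset0 enum_msetn.
  by rewrite /D_at T0 enum_mset0 asboolT.
exists a; apply/eqP; rewrite eq_le size_le_D_at // andbT.
exact: D_at_le.
Qed.

End Irreducible.

Theorem proposition1p1 (R : realType) (S : addSemigroupType)
    (S_nonempty : inhabited S) :
  (is_monoid S ->
     forall u : units S, D_at R (unit_val u) = D_at R u) /\
  ((D R S \is a fin_num <->
      exists M : int, forall a : S, (D_at R a <= (M%:~R)%:E)%E) /\
   (D R S \is a fin_num ->
      exists a : S,
        (forall b : S, (D_at R b <= D_at R a)%E) /\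
        D R S = (D_at R a + 1)%E)).
Proof.
split; first by move=> S_monoid u; exact: D_at_units.
by split; [exact: D_fin_num_bounded | exact: D_max].
Qed.
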